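(* Under the standing assumptions below, let $F_0(\gamma,x,s)=(1+\sum_{i=1}^I\gamma^i)L$. Then there exists $F^*\in\mathcal N$ with $\|\mathcal B^{(n)}(F_0)-F^*\|_{\mathcal M}\to0$ as $n\to\infty$ (where $\mathcal B^{(n)}$ is the $n$-fold iterate), and $F^*$ is the largest fixed point of $\mathcal B$ in $\mathcal N$: $\mathcal B(F^* )=F^*$, and every $F\in\mathcal N$ with $\mathcal B(F)=F$ satisfies $F\le F^*$ pointwise.
   Context: Setup. Let $\mathcal S$ be a finite set and $(s_t)_{t\ge0}$ a Markov chain on $\mathcal S$ with transition probabilities $\pi(s'|s)>0$ for all $s,s'\in\mathcal S$; $\mathbb E_{s_t}$ denotes expectation over future shocks conditional on the history $s^t=(s_0,\dots,s_t)$. Let $\mathcal A\subset\mathbb R^n$ be a finite set, $\mathcal X\subseteq\mathbb R^m$ a countable set, $\zeta:\mathcal X\times\mathcal A\times\mathcal S\to\mathcal X$, $p:\mathcal X\times\mathcal A\times\mathcal S\to\mathbb R$, $r,g^1,\dots,g^I:\mathcal X\times\mathcal A\times\mathcal S\to\mathbb R$ bounded functions, $\bar g^1,\dots,\bar g^I\in\mathbb R$ and $\beta\in(0,1)$. A plan is a family $a=(a(s^t))_{t\ge0,\,s^t\in\mathcal S^{t+1}}$ with $a(s^t)\in\mathcal A$; given $x_0$ it induces states $x(s^0)=x_0$, $x(s^{t+1})=\zeta(x(s^t),a(s^t),s_t)$. Let $\tilde{\mathcal A}(x,s)=\{a\in\mathcal A:p(x,a,s)\ge0\}$ and $\tilde{\mathcal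 A}^\infty(x_0)$ the set of plans with $a(s^t)\in\tilde{\mathcal A}(x(s^t),s_t)$ for all $t,s^t$. A plan is feasible for $(x_0,s_0)$ if it lies in $\tilde{\mathcal A}^\infty(x_0)$ and $\mathbb E_{s_t}\sum_{n\ge0}\beta^ng^i(x(s^{t+n}),a(s^{t+n}),s_{t+n})\ge\bar g^i$ for all $t,s^t,i$. Standing assumption: for every $(x_0,s_0)$ a feasible plan exists. Function spaces. Let $L=(\|r\|_\infty+\sum_{i=1}^I\|g^i\|_\infty)/(1-\beta)$, $B(k)=\{\gamma\in\mathbb R^I_+:\|\gamma\|_\infty\le k\}$, and enumerate $\mathcal S=\{s_1,\dots,s_{|\mathcal S|}\}$, $\mathcal X=\{x_1,x_2,\dots\}$. $\mathcal M$ is the set of $F:\mathbb R^I_+\times\mathcal X\times\mathcal S\to\mathbb R$ with $F(\cdot,x,s)\in L^\infty(B(k))$ for all $k\in\mathbb N_+$, $x,s$, and $\|F\|_{\mathcal M}:=\sum_{i}2^{-i}\sum_j2^{-j}\sum_{k\ge1}2^{-k}\|F(\cdot,x_j,s_i)\|_{L^\infty(B(k))}<\infty$. $\mathcal N\subset\mathcal M$ is the set of $F\in\mathcal M$ such that for all $x,s$: (i) $F(\cdot,x,s)$ is convex; (ii) $|F(\gamma_1,x,s)-F(\gamma_2,x,s)|\le L\|\gamma_1-\gamma_2\|_1$; (iii) $F(\gamma,x,s)\ge v^0+\sum_i\gamma^iv^i$ for every feasible plan for $(x,s)$, where $v^0=\mathbb E_{s}\sum_t\beta^tr(x(s^t),a(s^t),s_t)$,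 $v^i=\mathbb E_s\sum_t\beta^tg^i(x(s^t),a(s^t),s_t)$ (with $x_0=x,s_0=s$); (iv) $F(\gamma,x,s)\le(1+\sum_i\gamma^i)L$. Bellman operator: for $F:\mathbb R^I_+\times\mathcal X\times\mathcal S\to\mathbb R$, $\mathcal B(F)(\gamma,x,s)=\inf_{\lambda\in\mathbb R^I_+}\sup_{a\in\tilde{\mathcal A}(x,s)}\big[r(x,a,s)+\sum_i(\gamma^ig^i(x,a,s)+\lambda^i(g^i(x,a,s)-\bar g^i))+\beta\mathbb E_sF(\gamma+\lambda,\zeta(x,a,s),s')\big]$, where $\mathbb E_s$ is expectation over $s'\sim\pi(\cdot|s)$. *)

(* Defs.v *)
From HB Require Import structures.
From mathcomp Require Import all_boot all_order all_algebra.
From mathcomp Require Import all_classical all_reals all_analysis.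
Set Implicit Arguments. Unset Strict Implicit. Unset Printing Implicit Defensive.
Import Order.TTheory GRing.Theory Num.Theory.
Import numFieldNormedType.Exports.
Local Open Scope classical_set_scope.
Local Open Scope ring_scope.

(* trans s s' = pi(s'|s).  Multipliers gamma, lambda : 'I_I -> R.           *)
(* xenum j = Some x_{j+1} (the enumeration x_1, x_2, ... of X); None is used *)
(* to pad the enumeration when X is finite.                                  *)
Record model (R : realType) := Model {
  St : finType;
  Act : finType;
  Xs : Type;
  xenum : nat -> option Xs;
  nI : nat;
  trans : St -> St -> R;
  zeta : Xs -> Act -> St -> Xs;
  pfun : Xs -> Act -> St -> R;
  rfun : Xs -> Act -> St -> R;
  gfun : 'I_nI -> Xs -> Act -> St -> R;
  gbar : 'I_nI -> R;
  beta : R }.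


Arguments xenum {R}. Arguments trans {R}. Arguments zeta {R}. Arguments pfun {R}.
Arguments rfun {R}. Arguments gfun {R}. Arguments gbar {R}. Arguments beta {R}.

Definition mult (R : realType) (M : model R) := 'I_(nI M) -> R.

Definition nonneg (R : realType) (M : model R) : set (mult M) :=
  [set gam | forall i, 0 <= gam i].
Arguments nonneg {R} M.

(* A plan maps histories to actions.  A history s^t = (s_0,...,s_t) is stored
   REVERSED as the list [:: s_t; s_{t-1}; ...; s_0]. *)
Definition plan (R : realType) (M : model R) := seq (St M) -> Act M.

Definition hist_from (R : realType) (M : model R) (s0 : St M) (h : seq (St M)) : Prop :=
  match h with [::] => False | s :: t => last s t = s0 end.

Fixpoint xstate (R : realType) (M : model R) (a : plan M) (x0 : Xs M)
    (h : seq (St M)) : Xs M :=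
  match h with
  | [::] => x0
  | [:: _] => x0
  | _ :: ((s :: _) as h') => zeta M (xstate a x0 h') (a h') s
  end.

(* expectation of f(s^{t+n}) conditional on the history h = s^t *)
Fixpoint cexp (R : realType) (M : model R) (n : nat) (h : seq (St M))
    (f : seq (St M) -> R) : R :=
  match n with
  | 0 => f h
  | n'.+1 => match h with
             | [::] => 0
             | s :: _ => \sum_(s' : St M) trans M s s' * cexp n' (s' :: h) f
             end
  end.

(* E_{s_t} sum_{n>=0} beta^n f(x(s^{t+n}), a(s^{t+n}), s_{t+n}),
   written as the (convergent) series of conditional expectations *)
Definition value (R : realType) (M : model R) (a : plan M) (x0 : Xs M)
    (f : Xs M -> Act M -> St M -> R) (h : seq (St M)) : R :=
  limn (series (fun n => beta M ^+ n *
     cexp n h (fun h' => match h' with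
                         | [::] => 0
                         | s :: _ => f (xstate a x0 h') (a h') s
                         end))).

Definition Atil (R : realType) (M : model R) (x : Xs M) (s : St M) : set (Act M) :=
  [set a | 0 <= pfun M x a s].

Definition feasible (R : realType) (M : model R) (a : plan M) (x0 : Xs M) (s0 : St M)
    : Prop :=
  (forall h, hist_from s0 h ->
     match h with [::] => True | s :: _ => a h \in Atil (xstate a x0 h) s end) /\
  (forall h (i : 'I_(nI M)), hist_from s0 h ->
     gbar M i <= value a x0 (gfun M i) h).

Definition supnorm (R : realType) (M : model R) (f : Xs M -> Act M -> St M -> R) : R :=
  sup (range (fun t : Xs M * Act M * St M => `|f t.1.1 t.1.2 t.2|)).

Definition Lconst (R : realType) (M : model R) : R :=
  (supnorm (rfun M) + \sum_(i < nI M) supnorm (gfun M i)) / (1 - beta M).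

Definition Bop (R : realType) (M : model R) (F : mult M -> Xs M -> St M -> R)
    : mult M -> Xs M -> St M -> R :=
  fun gam x s =>
    inf [set sup [set rfun M x a s
                      + \sum_(i < nI M) (gam i * gfun M i x a s
                                         + lam i * (gfun M i x a s - gbar M i))
                      + beta M * \sum_(s' : St M) trans M s s' *
                                   F (fun i => gam i + lam i) (zeta M x a s) s'
                 | a in Atil x s]
         | lam in nonneg M].

Definition F0 (R : realType) (M : model R) : mult M -> Xs M -> St M -> R :=
  fun gam x s => (1 + \sum_(i < nI M) gam i) * Lconst M.
Arguments F0 {R} M.

Definition box (R : realType) (M : model R) (c : option (mult M * mult M)) : set (mult M) :=
  match c with
  | None => set0
  | Some ab => [set gam | forall i, ab.1 i <= gam i <= ab.2 i]
  end.

Definition vol (R : realType) (M : model R) (c : option (mult M * mult M)) : R :=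
  match c with
  | None => 0
  | Some ab => \prod_(i < nI M) (ab.2 i - ab.1 i)
  end.

Definition outer (R : realType) (M : model R) (E : set (mult M)) : \bar R :=
  ereal_inf [set (\sum_(n <oo) (vol (c n))%:E)%E
            | c in [set c : nat -> option (mult M * mult M) |
                     (forall n ab, c n = Some ab -> forall i, ab.1 i <= ab.2 i)
                     /\ E `<=` \bigcup_n box (c n)]].

Definition lnull (R : realType) (M : model R) (E : set (mult M)) : Prop :=
  outer E = 0%E.

Definition lmeas (R : realType) (M : model R) (E : set (mult M)) : Prop :=
  forall T, outer T = (outer (T `&` E) + outer (T `\` E))%E.

Definition Bk (R : realType) (M : model R) (k : nat) : set (mult M) :=
  [set gam | forall i, 0 <= gam i <= k%:R].
Arguments Bk {R} M k.

Definition lmeas_fun (R : realType) (M : model R) (f : mult M -> R) (k : nat) : Prop :=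
  forall c : R, lmeas [set gam | Bk M k gam /\ c < f gam].

(* ||f||_{L^oo(B(k))} = essential sup of |f| on B(k) (+oo if not ess. bounded) *)
Definition Linf (R : realType) (M : model R) (f : mult M -> R) (k : nat) : \bar R :=
  ereal_inf [set c%:E | c in [set c : R | 0 <= c /\
                         lnull [set gam | Bk M k gam /\ c < `|f gam|]]].

Definition mnorm (R : realType) (M : model R) (F : mult M -> Xs M -> St M -> R)
    : \bar R :=
  (\sum_(s : St M) (((2:R) ^- (enum_rank s).+1)%:E *
     \sum_(j <oo) match xenum M j with
                  | None => 0
                  | Some x => ((2:R) ^- j.+1)%:E *
                      \sum_(k <oo) (((2:R) ^- k.+1)%:E * Linf (fun g => F g x s) k.+1)
                  end))%E.

Definition inM (R : realType) (M : model R) (F : mult M -> Xs M -> St M -> R) : Prop :=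
  (forall (k : nat) x s, (0 < k)%N ->
      lmeas_fun (fun g => F g x s) k /\ (Linf (fun g => F g x s) k < +oo)%E)
  /\ (mnorm F < +oo)%E.

Definition inN (R : realType) (M : model R) (F : mult M -> Xs M -> St M -> R) : Prop :=
  inM F /\
  (forall x s (g1 g2 : mult M) (t : R), nonneg M g1 -> nonneg M g2 -> 0 <= t <= 1 ->
     F (fun i => t * g1 i + (1 - t) * g2 i) x s <= t * F g1 x s + (1 - t) * F g2 x s) /\
  (forall x s (g1 g2 : mult M), nonneg M g1 -> nonneg M g2 ->
     `|F g1 x s - F g2 x s| <= Lconst M * \sum_(i < nI M) `|g1 i - g2 i|) /\
  (forall x s (a : plan M) (gam : mult M), nonneg M gam -> feasible a x s ->
     value a x (rfun M) [:: s] + \sum_(i < nI M) gam i * value a x (gfun M i) [:: s]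
       <= F gam x s) /\
  (forall x s (gam : mult M), nonneg M gam ->
     F gam x s <= (1 + \sum_(i < nI M) gam i) * Lconst M).

(* Main.v *)
(* B is monotone and preserves conditions (i)-(iv): for (iii), the Bellman recursion for
   a feasible plan bounds the bracket from below uniformly in lambda, which also keeps
   the infimum finite. By (iv), B F_0 <= F_0, so B^n F_0 decreases pointwise to some F*,
   and (i)-(iv) pass to the limit. For fixed lambda the supremum runs over finitely many
   actions and hence commutes with the decreasing limit, so F* is a fixed point; any
   fixed point F in N satisfies F <= F_0, hence F = B^n F <= B^n F_0 for all n, hence
   F <= F*. The iterates are equi-Lipschitz, so the convergence is uniform on every B(k),
   and dominated convergence of series gives convergence in the norm of M. *)
Require Import Defs.
From HB Require Import structures.
From mathcomp Require Import all_boot all_order all_algebra.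
From mathcomp Require Import all_classical all_reals all_analysis.
From mathcomp Require Import ring lra.
Import Order.TTheory GRing.Theory Num.Theory.
Import numFieldNormedType.Exports.
Local Open Scope classical_set_scope.
Local Open Scope ring_scope.
Set Implicit Arguments.
Unset Strict Implicit.
Unset Printing Implicit Defensive.

(** * Lebesgue measurability of Lipschitz functions *)

Section OuterMeasure.
Context {R : realType} {M : model R}.
Implicit Types (E T : set (mult M)) (c : nat -> option (mult M * mult M)).

Definition box_cover E c :=
  (forall n ab, c n = Some ab -> forall i, ab.1 i <= ab.2 i) /\
  E `<=` \bigcup_n box (c n).

Lemma vol_ge0 E c n : box_cover E c -> (0 <= (vol (c n))%:E)%E.
Proof.
move=> [+ _] => /(_ n); case: (c n) => [ab|] //= le_ab; rewrite lee_fin //.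
by apply: prodr_ge0 => i _; rewrite subr_ge0; exact: le_ab.
Qed.

Lemma outer_le E c : box_cover E c -> (outer E <= \sum_(n <oo) (vol (c n))%:E)%E.
Proof. by move=> Ec; apply: ereal_inf_lbound; exists c. Qed.

Lemma outer_glb E (l : \bar R) :
  (forall c, box_cover E c -> (l <= \sum_(n <oo) (vol (c n))%:E)%E) ->
  (l <= outer E)%E.
Proof. by move=> Ecl; apply: le_ereal_inf_tmp => _ [c Ec <-]; exact: Ecl. Qed.

Lemma outer_ge0 E : (0 <= outer E)%E.
Proof.
by apply: outer_glb => c Ec; apply: nneseries_ge0 => n _ _; exact: vol_ge0 Ec.
Qed.

Lemma outer_set0 : outer (set0 : set (mult M)) = 0%E.
Proof.
apply/eqP; rewrite eq_le outer_ge0 andbT.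
apply: le_trans (_ : \sum_(n <oo) (vol (None : option (mult M * mult M)))%:E <= 0)%E.
  by apply: (@outer_le _ (fun=> None)); split => // ?.
by rewrite eseries0.
Qed.

Lemma outer_mono : {homo @outer R M : E T / E `<=` T >-> (E <= T)%E}.
Proof.
move=> E T ET; apply: outer_glb => c [c_le Tc]; apply: outer_le; split=> //.
exact: subset_trans Tc.
Qed.

Lemma outer_approx E (e : R) : 0 < e -> (outer E < +oo)%E ->
  exists2 c, box_cover E c & (\sum_(n <oo) (vol (c n))%:E <= outer E + e%:E)%E.
Proof.
move=> e0 Eoo; have Efin : outer E \is a fin_num by rewrite ge0_fin_numE ?outer_ge0.
by have [_ [c Ec <-] /ltW] := lb_ereal_inf_adherent e0 Efin; exists c.
Qed.

(** Each piece gets a cover with excess at most [e / 2 ^ n.+1]. A bijection between [nat] and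
    [nat * nat] merges these covers into a single sequence, and nonnegativity allows the double sum
    to be rearranged. *)
Lemma outer_bigcup : sigma_subadditive (@outer R M).
Proof.
move=> A; have [[i Aioo]|Afin] := pselect (exists i, outer (A i) = +oo%E).
  (* If a piece has infinite outer measure the right-hand side is [+oo]; otherwise near-optimal
     covers of all pieces exist. *)
  by rewrite (nneseries_pinfty _ _ Aioo) ?leey// => n _; exact: outer_ge0.
apply/lee_addgt0Pr => e e0.
apply: le_trans (epsilon_trick xpredT (fun n => outer_ge0 (A n)) (ltW e0)).
have /choice[G PG] n : exists c, box_cover (A n) c /\
    (\sum_(k <oo) (vol (c k))%:E <= outer (A n) + (e / (2 ^ n.+1)%:R)%:E)%E.
  have e2 : 0 < e / (2 ^ n.+1)%:R by rewrite divr_gt0// ltr0n expn_gt0.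
  have [|c] := outer_approx e2 (E := A n); last by exists c.
  by rewrite ltey; apply/eqP => Ay; apply: Afin; exists n.
have /card_esym/ppcard_eqP[f] := card_nat2.
pose v (p : nat * nat) := (vol (G p.1 p.2))%:E.
have v0 p : (0 <= v p)%E by exact: vol_ge0 (PG p.1).1.
apply: (@le_trans _ _ (\esum_(p in setT) v p)%E).
  have <- : (\sum_(n <oo) v (f n) = \esum_(p in setT) v p)%E.
    rewrite nneseries_esumT//; apply/esym.
    by apply: (reindex_esum setT setT) => //.
  apply: (outer_le (c := fun n => G (f n).1 (f n).2)); split=> [n|g [n _ Ang]].
    exact: (PG (f n).1).1.1.
  have [k _ Gg] := (PG n).1.2 _ Ang.
  by exists (f^-1%FUN (n, k)) => //; rewrite invK ?inE.
rewrite (_ : setT = setT `*`` (fun=> setT)); last by apply/seteqP; split=> -[].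
rewrite -(esum_esum (a := fun i j => v (i, j)))// -nneseries_esumT; last first.
  by move=> n; apply: esum_ge0.
apply: lee_nneseries => [n _ _|n _]; first exact: esum_ge0.
by rewrite -nneseries_esumT//; exact: (PG n).2.
Qed.

HB.instance Definition _ := isOuterMeasure.Build R (mult M) (@outer R M)
  outer_set0 outer_ge0 outer_mono outer_bigcup.

(** [lmeas] is Carathéodory's criterion for [outer], so the closure properties of
    Carathéodory-measurable sets transfer to it. *)
Lemma lmeasE E : lmeas E <-> (@outer R M).-caratheodory E.
Proof. by split=> mE T; rewrite -?setDE; [|rewrite setDE]; exact: mE. Qed.

Definition upd (g : mult M) (i : 'I_(nI M)) (t : R) : mult M :=
  fun j => if j == i then t else g j.

(** The volume is affine in each endpoint of the i-th side, so additivity holds even when [t] lies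
    outside that side. *)
Lemma vol_split (a b : mult M) i t :
  vol (Some (a, upd b i t)) + vol (Some (upd a i t, b)) = vol (Some (a, b)).
Proof.
rewrite /= !(bigD1 (P := xpredT) i)//= /upd eqxx.
under eq_bigr => j ji do rewrite (negbTE ji).
under [X in _ + _ * X = _]eq_bigr => j ji do rewrite (negbTE ji).
by rewrite -mulrDl [X in X * _]addrC addrA subrK.
Qed.

(* Clamping the cut value [t] to the i-th side of a box splits it into two boxes, one of
   them possibly degenerate, whose volumes add up exactly. *)
Lemma lmeas_halfspace i t : lmeas [set g : mult M | g i <= t].
Proof.
apply/lmeasE/le_caratheodory_measurable => T; rewrite -setDE.
apply: outer_glb => c [c_le Tc].
pose clamp (ab : mult M * mult M) := Num.max (ab.1 i) (Num.min t (ab.2 i)).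
pose lo n := if c n is Some ab then Some (ab.1, upd ab.2 i (clamp ab)) else None.
pose hi n := if c n is Some ab then Some (upd ab.1 i (clamp ab), ab.2) else None.
have Tlo : box_cover (T `&` [set g | g i <= t]) lo.
  split=> [n ab|g [Tg gt]].
    rewrite /lo; case: (c n) (c_le n) => // [[a b]] /(_ _ erefl) ab_le [<-] j /=.
    by rewrite /upd; case: eqP => // ->; rewrite /clamp le_max lexx.
  have [n _] := Tc _ Tg; rewrite /lo; case E: (c n) => [[a b]|]// ab_g.
  exists n => //; rewrite E /= => j; rewrite /upd; case: eqP => [->|_] //.
  have /andP[ag gb] := ab_g i.
  by rewrite ag /clamp le_max le_min gt gb orbT.
have Thi : box_cover (T `\` [set g | g i <= t]) hi.
  split=> [n ab|g [Tg /negP]].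
    rewrite /hi; case: (c n) (c_le n) => // [[a b]] /(_ _ erefl) ab_le [<-] j /=.
    rewrite /upd; case: eqP => // ->; rewrite /clamp ge_max ge_min lexx orbT andbT.
    exact: ab_le.
  rewrite -ltNge => gt; have [n _] := Tc _ Tg.
  rewrite /hi; case E: (c n) => [[a b]|]// ab_g.
  exists n => //; rewrite E /= => j; rewrite /upd; case: eqP => [->|_] //.
  have /andP[ag gb] := ab_g i.
  by rewrite gb /clamp ge_max ge_min (ltW gt) ag.
have -> : (\sum_(n <oo) (vol (c n))%:E =
    \sum_(n <oo) (vol (lo n))%:E + \sum_(n <oo) (vol (hi n))%:E)%E.
  rewrite -nneseriesD; last 2 first.
  - by move=> n _ _; exact: vol_ge0 Tlo.
  - by move=> n _ _; exact: vol_ge0 Thi.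
  apply: eq_eseriesr => n _; rewrite -EFinD /lo /hi.
  by case: (c n) => [[a b]|]; rewrite ?vol_split//= addr0.
by apply: leeD; exact: outer_le.
Qed.

Lemma lmeasC E : lmeas E -> lmeas (~` E).
Proof. by move=> /lmeasE mE; apply/lmeasE/caratheodory_measurable_setC. Qed.

Lemma lmeasI E T : lmeas E -> lmeas T -> lmeas (E `&` T).
Proof. by move=> /lmeasE mE /lmeasE mT; apply/lmeasE/caratheodory_measurable_setI. Qed.

Lemma lmeas0 : lmeas (set0 : set (mult M)).
Proof. exact/lmeasE/caratheodory_measurable_set0. Qed.

(** Indices are run through [nat] by [unpickle]; numbers that code no index in [D] contribute the
    empty set. *)
Lemma lmeas_bigcup (I : countType) (D : set I) (E : I -> set (mult M)) :
  (forall i, D i -> lmeas (E i)) -> lmeas (\bigcup_(i in D) E i).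
Proof.
move=> mE; pose A n := if unpickle n is Some i then
  if pselect (D i) then E i else set0 else set0.
have -> : \bigcup_(i in D) E i = \bigcup_n A n.
  apply/seteqP; split=> g [i Di Eg].
    by exists (pickle i) => //; rewrite /A pickleK; case: pselect.
  move: Eg; rewrite /A; case: (unpickle i) => // j; case: pselect => // Dj Eg.
  by exists j.
apply/lmeasE/caratheodory_measurable_bigcup => n; apply/lmeasE; rewrite /A.
case: unpickle => [i|]; last exact: lmeas0.
by case: (pselect (D i)) => Di; [exact: mE|exact: lmeas0].
Qed.

Lemma lmeas_fin_bigcap (I : finType) (E : I -> set (mult M)) :
  (forall i, lmeas (E i)) -> lmeas [set g | forall i, E i g].
Proof.
move=> mE; rewrite (_ : mkset _ = ~` \bigcup_i ~` E i).
  by apply/lmeasC/lmeas_bigcup => i _; exact/lmeasC.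
by rewrite setC_bigcup; under eq_bigcapr do rewrite setCK; apply/seteqP; split=> g Eg i //;
  exact: Eg.
Qed.

Lemma lmeas_slab i (s t : R) : lmeas [set g : mult M | s <= g i <= t].
Proof.
(* The closed lower constraint is the complement of the increasing union of the half-spaces
   [g i <= s - 1/(n+1)]. *)
rewrite (_ : mkset _ =
   ~` (\bigcup_n [set g : mult M | g i <= s - n.+1%:R^-1]) `&` [set g | g i <= t]).
  apply: lmeasI; last exact: lmeas_halfspace.
  by apply/lmeasC/lmeas_bigcup => n _; exact: lmeas_halfspace.
apply/seteqP; split=> g /= => [/andP[sg gt]|[gn gt]].
  split=> // -[n _ /=]; apply/negP; rewrite -ltNge; apply: lt_le_trans sg.
  by rewrite ltrBlDr ltrDl invr_gt0 ltr0n.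
rewrite gt andbT leNgt; apply/negP => gs.
have [n /ltW n_lt] := ltr_add_invr gs.
by apply: gn; exists n; rewrite //= lerBrDr.
Qed.

Lemma lmeas_box (a b : mult M) : lmeas (box (Some (a, b))).
Proof.
exact: (lmeas_fin_bigcap (E := fun i => [set g : mult M | a i <= g i <= b i])
  (fun i => lmeas_slab i (a i) (b i))).
Qed.

Lemma grid_cell (t : R) m : 0 <= t ->
  (Num.truncn (t * m.+1%:R))%:R / m.+1%:R <= t
    <= (Num.truncn (t * m.+1%:R)).+1%:R / m.+1%:R.
Proof.
move=> t0; have m0 : (0 : R) < m.+1%:R by rewrite ltr0n.
rewrite ler_pdivrMr// ler_pdivlMr//.
by have /andP[-> /ltW ->//] := truncn_itv (mulr_ge0 t0 (ltW m0)).
Qed.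

Lemma nonneg_Bk k : Bk M k `<=` nonneg M.
Proof. by move=> g gk i; have /andP[] := gk i. Qed.

Definition lipschitz_on_nonneg (K : R) (f : mult M -> R) :=
  forall g1 g2, nonneg M g1 -> nonneg M g2 ->
    `|f g1 - f g2| <= K * \sum_(i < nI M) `|g1 i - g2 i|.

(** The strict superlevel set is the union of all rational grid cells, clipped to [Bk M k], that it
    contains. There are countably many, and the Lipschitz bound puts every point of the set in such
    a cell once the mesh is fine. *)
Lemma lmeas_fun_lipschitz (f : mult M -> R) (K : R) k :
  lipschitz_on_nonneg K f -> lmeas_fun f k.
Proof.
move=> f_lip c.
pose cell (q : nat * {ffun 'I_(nI M) -> nat}) : set (mult M) :=
  box (Some (fun i => (q.2 i)%:R / q.1.+1%:R, fun i => (q.2 i).+1%:R / q.1.+1%:R)).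
pose E := [set g | Bk M k g /\ c < f g].
rewrite -/E (_ : E = \bigcup_(q in [set q | Bk M k `&` cell q `<=` E]) (Bk M k `&` cell q)).
  apply: lmeas_bigcup => q _; apply: lmeasI; last exact: lmeas_box.
  exact: (@lmeas_box (fun=> 0) (fun=> k%:R)).
apply/seteqP; split=> [g Eg|g [q qE]]; last exact: qE.
have [gk cf] := Eg; have g0 := nonneg_Bk gk.
(* With mesh below [d], [f] varies by less than [f g - c] across a cell. The sign of [K] is not
   assumed, hence the absolute value; the added 1 keeps the denominator positive. *)
pose d := (f g - c) / (`|K| * (nI M)%:R + 1).
have Kn : 0 < `|K| * (nI M)%:R + 1 by rewrite ltr_pwDr// mulr_ge0.
have d0 : 0 < d by rewrite divr_gt0// subr_gt0.
have [m] := ltr_add_invr d0; rewrite add0r => md.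
pose q := (m, [ffun i => Num.truncn (g i * m.+1%:R)]).
have gq i : (q.2 i)%:R / q.1.+1%:R <= g i <= (q.2 i).+1%:R / q.1.+1%:R.
  by rewrite /q /= ffunE grid_cell.
exists q => // g' [gk' gq']; split=> //.
have g0' := nonneg_Bk gk'.
have gg' i : `|g i - g' i| <= m.+1%:R^-1.
  have /andP[lo hi] := gq i.
  have /andP[lo' hi'] : (q.2 i)%:R / q.1.+1%:R <= g' i <= (q.2 i).+1%:R / q.1.+1%:R.
    exact: gq'.
  have dE : (q.2 i).+1%:R / q.1.+1%:R = (q.2 i)%:R / q.1.+1%:R + m.+1%:R^-1 :> R.
    by rewrite -[(_.+1)%:R]natr1 mulrDl mul1r.
  have close (u v w z : R) :
      u <= v -> v <= u + z -> u <= w -> w <= u + z -> `|v - w| <= z.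
    by move=> *; rewrite ler_distl; apply/andP; split; lra.
  by rewrite dE in hi hi'; exact: close lo hi lo' hi'.
have fgg' : f g - f g' <= `|K| * (nI M)%:R * m.+1%:R^-1.
  apply: le_trans (ler_norm _) _; apply: le_trans (f_lip _ _ g0 g0') _.
  apply: le_trans (ler_wpM2r _ (ler_norm K)) _; first exact: sumr_ge0.
  rewrite -mulrA ler_wpM2l//; apply: le_trans (ler_sum _ (fun i _ => gg' i)) _.
  by rewrite sumr_const card_ord mulr_natl.
have : `|K| * (nI M)%:R * m.+1%:R^-1 < f g - c.
  apply: (@le_lt_trans _ _ ((`|K| * (nI M)%:R + 1) * m.+1%:R^-1)).
    by rewrite ler_wpM2r// ?invr_ge0 ?ler0n// lerDl.
  by rewrite mulrC -ltr_pdivlMr.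
by move=> /(le_lt_trans fgg'); rewrite ltrD2l ltrN2.
Qed.

End OuterMeasure.

(** * Convergence in the norm of M *)

Section NonnegativeSeries.
Context {R : realType}.
Local Open Scope ereal_scope.

(** Conversely, real tolerances bound the limsup by every [e > 0]; with nonnegative terms this
    forces convergence to 0, even if early terms are infinite. *)
Lemma cvge0P (u : (\bar R)^nat) : (forall n, 0 <= u n) ->
  (u @ \oo --> 0) <-> (forall e : R, (0 < e)%R -> \forall n \near \oo, u n <= e%:E).
Proof.
move=> u0; split=> [u_cvg e e0|u_near].
  have : \forall n \near \oo, u n < e%:E.
    by apply: (u_cvg [set y | y < e%:E]); apply: open_ereal_lt'; rewrite lte_fin.
  by apply: filterS => n /ltW.
apply: limn_esup_le_cvg => //; rewrite limn_esup_lim.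
apply/lee_addgt0Pr => e e0; rewrite add0e; apply: lime_le; first exact: is_cvg_esups.
have [N _ uN] := u_near e e0; exists N => // n /= Nn.
by apply: ge_ereal_sup => _ [m /= nm <-]; apply: uN => /=; exact: leq_trans nm.
Qed.

Lemma nneseries_le (u : (\bar R)^nat) (c : R) : (forall n, 0 <= u n) ->
  (forall n, \sum_(0 <= k < n) u k <= c%:E) -> \sum_(k <oo) u k <= c%:E.
Proof.
move=> u0 uc; apply: lime_le; first by apply: is_cvg_nneseries => n _ _.
exact: nearW.
Qed.

(* Tannery's theorem *)
Lemma nneseries_dominated_cvg0 (u : nat -> (\bar R)^nat) (b : (\bar R)^nat) :
  (forall n k, 0 <= u n k) -> (forall n k, u n k <= b k) ->
  \sum_(k <oo) b k < +oo -> (forall k, u ^~ k @ \oo --> 0) ->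
  (fun n => \sum_(k <oo) u n k) @ \oo --> 0.
Proof.
move=> u0 ub boo u_cvg; have b0 k : 0 <= b k := le_trans (u0 0%N k) (ub 0%N k).
apply/cvge0P => [n|e e0]; first by apply: nneseries_ge0 => k _ _.
have e2 : (0 < e / 2)%R by rewrite divr_gt0.
have tail0 n : 0 <= \sum_(n <= k <oo) b k by apply: nneseries_ge0 => k _ _.
(* Half of [e] pays for the tail of the dominating series, uniformly in [n]; the other half pays for
   the finitely many leading terms. *)
have /(cvge0P tail0)/(_ _ e2)[N _ tailN] :=
  nneseries_tail_cvg boo (fun k _ => b0 k).
have : (fun n => \sum_(0 <= k < N) u n k) @ \oo --> \sum_(0 <= k < N) (0 : \bar R).
  by apply: cvg_nnesum => [k _|k _]; [exact: nearW|exact: u_cvg].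
rewrite big1// => /cvge0P head; have := head _ _ e2.
have {}head n : 0 <= \sum_(0 <= k < N) u n k by exact: sume_ge0.
move=> /(_ head); apply: filterS => n un.
rewrite (nneseries_split 0 N)//.
rewrite [e]splitr EFinD !add0n leeD//.
apply: le_trans (tailN N (leqnn N)).
by apply: lee_nneseries => [k _ _|k _]; [exact: u0|exact: ub].
Qed.

Lemma half_weights_lim (c : R) : (0 <= c)%R ->
  \sum_(k <oo) ((2:R) ^- k.+1)%:E * c%:E <= c%:E.
Proof.
move=> c0; apply: nneseries_le => [n|n].
  by rewrite -EFinM lee_fin mulr_ge0// invr_ge0 exprn_ge0.
under eq_bigr do rewrite -EFinM.
rewrite sumEFin lee_fin -mulr_suml ler_piMl//.
suff -> : (\sum_(0 <= k < n) (2:R) ^- k.+1 = 1 - 2 ^- n)%R.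
  by rewrite lerBlDr lerDl invr_ge0 exprn_ge0.
elim: n => [|n IH]; first by rewrite big_nil expr0 invr1 subrr.
have step (z : R) : (1 - z + 2^-1 * z = 1 - 2^-1 * z)%R by lra.
by rewrite big_nat_recr//= IH exprS invfM step.
Qed.

Lemma half_weights_linear_lim (c : R) : (0 <= c)%R ->
  \sum_(k <oo) ((2:R) ^- k.+1)%:E * (k.+1%:R * c)%:E <= (2 * c)%:E.
Proof.
move=> c0; apply: nneseries_le => [n|n].
  by rewrite -EFinM lee_fin mulr_ge0// ?mulr_ge0// invr_ge0 exprn_ge0.
under eq_bigr do rewrite -EFinM mulrA.
rewrite sumEFin lee_fin -mulr_suml ler_wpM2r//.
(* The closed form of the partial sums shows that they stay below 2, the value of the series. *)
suff -> : (\sum_(0 <= k < n) (2:R) ^- k.+1 * k.+1%:R = 2 - (n%:R + 2) * 2 ^- n)%R.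
  by rewrite lerBlDr lerDl mulr_ge0// ?addr_ge0// invr_ge0 exprn_ge0.
elim: n => [|n IH]; first by rewrite big_nil expr0 invr1 add0r mulr1 subrr.
have step (m z : R) :
  (2 - (m + 2) * z + 2^-1 * z * (m + 1) = 2 - (m + 1 + 2) * (2^-1 * z))%R by lra.
by rewrite big_nat_recr//= IH exprS invfM -[n.+1%:R%R]natr1 step.
Qed.

End NonnegativeSeries.

(** * The weighted norm on M and linear growth *)

Section MNorm.
Context {R : realType} {M : model R}.
Implicit Types (f : mult M -> R) (F : mult M -> Xs M -> St M -> R).
Local Open Scope ereal_scope.

Lemma Linf_ge0 f k : 0 <= Linf f k.
Proof. by apply: le_ereal_inf_tmp => _ [c [c0 _] <-]; rewrite lee_fin. Qed.

(** A pointwise bound on [Bk M k] makes the exceptional set empty, hence null. *)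
Lemma Linf_le f k (c : R) : (0 <= c)%R ->
  (forall g, Bk M k g -> (`|f g| <= c)%R) -> Linf f k <= c%:E.
Proof.
move=> c0 fc; apply: ereal_inf_lbound; exists c => //; split=> //.
rewrite (_ : mkset _ = set0) /lnull ?outer_set0//.
by apply/seteqP; split=> // g [/fc]; rewrite leNgt => /negP.
Qed.

Lemma sum_Bk k (g : mult M) : Bk M k g ->
  (\sum_(i < nI M) g i <= (nI M)%:R * k%:R)%R.
Proof.
move=> gk; apply: (@le_trans _ _ (\sum_(i < nI M) k%:R)%R).
  by apply: ler_sum => i _; have /andP[] := gk i.
by rewrite sumr_const card_ord mulr_natl.
Qed.

Lemma ge0_growth (C : R) k : (0 <= C)%R -> (0 <= (1 + (nI M)%:R * k%:R) * C)%R.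
Proof. by move=> C0; rewrite mulr_ge0// addr_ge0// mulr_ge0. Qed.

(** Linear growth in the multipliers becomes linear growth in [k], which the weights [2^-k] can
    sum. *)
Lemma Linf_growth f k (C : R) : (0 <= C)%R ->
  (forall g, nonneg M g -> (`|f g| <= (1 + \sum_(i < nI M) g i) * C)%R) ->
  Linf f k <= ((1 + (nI M)%:R * k%:R) * C)%:E.
Proof.
move=> C0 fC; apply: Linf_le => [|g gk]; first exact: ge0_growth.
apply: le_trans (fC g (nonneg_Bk gk)) _.
by rewrite ler_wpM2r// lerD2l sum_Bk.
Qed.

Definition mnorm_slice f := \sum_(k <oo) ((2:R) ^- k.+1)%:E * Linf f k.+1.

Lemma half_pow_ge0 k : 0 <= ((2:R) ^- k.+1)%:E.
Proof. by rewrite lee_fin invr_ge0 exprn_ge0. Qed.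
Local Hint Resolve half_pow_ge0 : core.

Lemma mnorm_slice_ge0 f : 0 <= mnorm_slice f.
Proof. by apply: nneseries_ge0 => k _ _; rewrite mule_ge0// Linf_ge0. Qed.

(** The constant part is summed by the weights [2^-k], of total mass 1, and the linear part by
    [k 2^-k], of total mass 2. *)
Lemma growth_series (C : R) : (0 <= C)%R ->
  \sum_(k <oo) ((2:R) ^- k.+1)%:E * ((1 + (nI M)%:R * k.+1%:R) * C)%:E
    <= (C + 2 * ((nI M)%:R * C))%:E.
Proof.
move=> C0; have nC0 : (0 <= (nI M)%:R * C)%R by rewrite mulr_ge0.
rewrite (eq_eseriesr (g := fun k => ((2:R) ^- k.+1)%:E * C%:E +
    ((2:R) ^- k.+1)%:E * (k.+1%:R * ((nI M)%:R * C))%:E)); last first.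
  by move=> k _; rewrite -!EFinM -EFinD; congr EFin; ring.
rewrite nneseriesD => [|k _ _|k _ _]; last 2 first.
- by rewrite mule_ge0// lee_fin.
- by rewrite mule_ge0// lee_fin mulr_ge0.
by rewrite EFinD leeD// ?half_weights_lim ?half_weights_linear_lim.
Qed.

Lemma mnorm_slice_growth f (C : R) : (0 <= C)%R ->
  (forall g, nonneg M g -> (`|f g| <= (1 + \sum_(i < nI M) g i) * C)%R) ->
  mnorm_slice f <= (C + 2 * ((nI M)%:R * C))%:E.
Proof.
move=> C0 fC; apply: le_trans (growth_series C0).
apply: lee_nneseries => [k _ _|k _]; first by rewrite mule_ge0// Linf_ge0.
by rewrite lee_wpmul2l// Linf_growth.
Qed.

Lemma mnormE F : mnorm F = \sum_(s : St M) ((2:R) ^- (enum_rank s).+1)%:E *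
   \sum_(j <oo) (if xenum M j is Some x then ((2:R) ^- j.+1)%:E * mnorm_slice (fun g => F g x s)
                 else 0).
Proof. by []. Qed.

(** Members of N satisfy this with [C = L], and differences of two members with [C = 2 L]; it
    supplies the dominating series for the norm. *)
Definition growth_bound F (C : R) := forall x s g, nonneg M g ->
  (`|F g x s| <= (1 + \sum_(i < nI M) g i) * C)%R.

Lemma xenum_slice_ge0 F s j : 0 <= (if xenum M j is Some x then
  ((2:R) ^- j.+1)%:E * mnorm_slice (fun g => F g x s) else 0).
Proof. by case: xenum => // x; rewrite mule_ge0// mnorm_slice_ge0. Qed.

Lemma xenum_slice_growth F C s j : (0 <= C)%R -> growth_bound F C ->
  (if xenum M j is Some x then ((2:R) ^- j.+1)%:E * mnorm_slice (fun g => F g x s)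
   else 0) <= ((2:R) ^- j.+1)%:E * (C + 2 * ((nI M)%:R * C))%:E.
Proof.
move=> C0 FC; case: xenum => [x|].
  by rewrite lee_wpmul2l// mnorm_slice_growth// => g; exact: FC.
(* A padding entry [None] contributes 0, so only the sign of the bound matters. *)
by rewrite mule_ge0// lee_fin addr_ge0// !mulr_ge0.
Qed.

Lemma xenum_growth_series (C : R) : (0 <= C)%R ->
  \sum_(j <oo) ((2:R) ^- j.+1)%:E * (C + 2 * ((nI M)%:R * C))%:E < +oo.
Proof.
move=> C0; apply: le_lt_trans (half_weights_lim _) (ltry _).
by rewrite addr_ge0// !mulr_ge0.
Qed.

Lemma mnorm_lty F (C : R) : (0 <= C)%R -> growth_bound F C -> mnorm F < +oo.
Proof.
move=> C0 FC; rewrite mnormE; apply: lte_sum_pinfty => s _.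
apply: lte_mul_pinfty => //; apply: le_lt_trans (xenum_growth_series C0).
by apply: lee_nneseries => [j _ _|j _]; [exact: xenum_slice_ge0|exact: xenum_slice_growth].
Qed.

(** Dominated convergence is applied twice, first over the radii [k] at a fixed state and then over
    the enumeration of [Xs]; the outer sum over shocks is finite. *)
Lemma mnorm_cvg0 (F : nat -> mult M -> Xs M -> St M -> R) (C : R) : (0 <= C)%R ->
  (forall n, growth_bound (F n) C) ->
  (forall x s k (e : R), (0 < e)%R -> \forall n \near \oo,
     forall g, Bk M k g -> (`|F n g x s| <= e)%R) ->
  (fun n => mnorm (F n)) @ \oo --> 0.
Proof.
move=> C0 FC F_cvg.
have slice_cvg x s : mnorm_slice (fun g => F n g x s) @[n --> \oo] --> 0.
  apply: (nneseries_dominated_cvg0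
    (b := fun k => ((2:R) ^- k.+1)%:E * ((1 + (nI M)%:R * k.+1%:R) * C)%:E)).
  - by move=> n k; rewrite mule_ge0// Linf_ge0.
  - by move=> n k; rewrite lee_wpmul2l// Linf_growth// => g; exact: FC.
  - exact: le_lt_trans (growth_series C0) (ltry _).
  - move=> k; rewrite -(mule0 ((2:R) ^- k.+1)%:E); apply: cvgeZl => //.
    apply/cvge0P => [n|e e0]; first exact: Linf_ge0.
    by apply: filterS (F_cvg x s k.+1 e e0) => n Fn; apply: Linf_le => //; exact: ltW.
have : (fun n => \sum_(s : St M) ((2:R) ^- (enum_rank s).+1)%:E *
   \sum_(j <oo) (if xenum M j is Some x then
     ((2:R) ^- j.+1)%:E * mnorm_slice (fun g => F n g x s) else 0)) @ \oo -->
   \sum_(s : St M) (0 : \bar R).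
  apply: cvg_nnesum => s _.
    apply: nearW => n; rewrite mule_ge0//.
    by apply: nneseries_ge0 => j _ _; exact: xenum_slice_ge0.
  rewrite -[X in _ --> X](mule0 ((2:R) ^- (enum_rank s).+1)%:E); apply: cvgeZl => //.
  apply: (nneseries_dominated_cvg0 (u := fun n j => if xenum M j is Some x then
      ((2:R) ^- j.+1)%:E * mnorm_slice (fun g => F n g x s) else 0)
    (b := fun j => ((2:R) ^- j.+1)%:E * (C + 2 * ((nI M)%:R * C))%:E)).
  - by move=> n j; exact: xenum_slice_ge0.
  - by move=> n j; exact: xenum_slice_growth.
  - exact: xenum_growth_series.
  - move=> j; case: xenum => [x|]; last exact: cvg_cst.
    by rewrite -(mule0 ((2:R) ^- j.+1)%:E); apply: cvgeZl.
by rewrite big1.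
Qed.

End MNorm.

(** * From pointwise to uniform convergence on B(k) *)

Section UniformConvergence.
Context {R : realType} {M : model R}.

(** Pointwise convergence is uniform on a finite grid of [Bk M k]; the common Lipschitz constant
    carries it from the grid to every point. *)
Lemma equilipschitz_uniform_cvg (f : nat -> mult M -> R) (l : mult M -> R) (K : R) k e :
  0 <= K -> (forall n, lipschitz_on_nonneg K (f n)) -> lipschitz_on_nonneg K l ->
  (forall g, nonneg M g -> f n g @[n --> \oo] --> l g) -> 0 < e ->
  \forall n \near \oo, forall g, Bk M k g -> `|f n g - l g| <= e.
Proof.
move=> K0 f_lip l_lip f_cvg e0.
(* The two Lipschitz moves to the grid cost at most [2 K nI d <= e / 2]; the other half is the error
   at the grid point. *)
pose d := e / 2 / (2 * K * (nI M)%:R + 1).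
have c0 : 0 < 2 * K * (nI M)%:R + 1 by rewrite ltr_pwDr// !mulr_ge0.
have d0 : 0 < d by rewrite divr_gt0// divr_gt0.
have [m] := ltr_add_invr d0; rewrite add0r => md.
pose p (j : {ffun 'I_(nI M) -> 'I_(k * m.+1).+1}) : mult M := fun i => (j i)%:R / m.+1%:R.
have p0 j : nonneg M (p j) by move=> i; rewrite divr_ge0.
have e2 : 0 < e / 2 by rewrite divr_gt0.
have : \forall n \near \oo, forall j, `|f n (p j) - l (p j)| <= e / 2.
  apply: filter_forall => j.
  have /cvgrPdist_le/(_ _ e2) := f_cvg _ (p0 j).
  by apply: filterS => n; rewrite distrC.
apply: filterS => n fn g gk; have g0 := nonneg_Bk gk.
pose j := [ffun i => inord (Num.truncn (g i * m.+1%:R))] : {ffun 'I_(nI M) -> 'I_(k * m.+1).+1}.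
have gp : \sum_(i < nI M) `|g i - p j i| <= (nI M)%:R * d.
  apply: (@le_trans _ _ (\sum_(i < nI M) d)); last by rewrite sumr_const card_ord mulr_natl.
  apply: ler_sum => i _; apply: le_trans (ltW md).
  (* Since [g i <= k], the truncation is at most [k * m.+1], so [inord] does not alter it. *)
  have jE : (j i : nat) = Num.truncn (g i * m.+1%:R).
    rewrite ffunE inordK// ltnS -(ler_nat R).
    have /andP[le _] := truncn_itv (mulr_ge0 (g0 i) (ler0n R m.+1)).
    apply: le_trans le _; rewrite natrM ler_wpM2r//.
    by have /andP[] := gk i.
  have /andP[lo hi] := grid_cell m (g0 i).
  rewrite /p jE ger0_norm ?subr_ge0// lerBlDl; apply: le_trans hi _.
  by rewrite -[_.+1%:R]natr1 mulrDl mul1r.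
have pg : \sum_(i < nI M) `|p j i - g i| <= (nI M)%:R * d.
  by under eq_bigr do rewrite distrC.
have f_near := le_trans (f_lip n _ _ g0 (p0 j)) (ler_wpM2l K0 gp).
have l_near := le_trans (l_lip _ _ (p0 j) g0) (ler_wpM2l K0 pg).
have -> : f n g - l g = (f n g - f n (p j)) + (f n (p j) - l (p j)) + (l (p j) - l g) by ring.
apply: le_trans (ler_normD _ _) _; apply: le_trans (lerD (ler_normD _ _) l_near) _.
apply: le_trans (lerD (lerD f_near (fn j)) (lexx _)) _.
have -> : K * ((nI M)%:R * d) + e / 2 + K * ((nI M)%:R * d) =
  (2 * K * (nI M)%:R) * d + e / 2 by ring.
rewrite [leRHS]splitr lerD2r.
rewrite -[leRHS](divfK (lt0r_neq0 c0)) -/d mulrC ler_wpM2l ?(ltW d0)//.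
by rewrite lerDl.
Qed.

End UniformConvergence.

Lemma cvgn_sum (R : realType) (I : finType) (f : I -> R^nat) (l : I -> R) :
  (forall i, f i @ \oo --> l i) -> (fun n => \sum_i f i n) @ \oo --> \sum_i l i.
Proof. by move=> fl; apply: cvg_big => //; exact: add_continuous. Qed.

(** * Plans, the Bellman operator and its iterates *)

Section DynamicProgram.
Context {R : realType} {M : model R}.
Hypothesis trans_pos : forall s s' : St M, 0 < trans M s s'.
Hypothesis trans_sum : forall s : St M, \sum_(s' : St M) trans M s s' = 1.
Hypothesis beta_pos : 0 < beta M.
Hypothesis beta_lt1 : beta M < 1.
Hypothesis r_bdd : exists b : R, forall x a s, `|rfun M x a s| <= b.
Hypothesis g_bdd : forall i, exists b : R, forall x a s, `|gfun M i x a s| <= b.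
Hypothesis feasible_ex : forall x s, exists a : plan M, feasible a x s.
Implicit Types (a : plan M) (x : Xs M) (s : St M) (h : seq (St M))
  (f : Xs M -> Act M -> St M -> R) (phi : seq (St M) -> R).

(** * Conditional expectations and discounted values of plans *)

Lemma trans_average_le s (phi : St M -> R) c : (forall s', phi s' <= c) ->
  \sum_(s' : St M) trans M s s' * phi s' <= c.
Proof.
move=> le_c; rewrite -[leRHS]mul1r -(trans_sum s) mulr_suml.
by apply: ler_sum => s' _; rewrite ler_wpM2l// ltW.
Qed.

Lemma trans_average_mono s (phi psi : St M -> R) : (forall s', phi s' <= psi s') ->
  \sum_(s' : St M) trans M s s' * phi s' <= \sum_(s' : St M) trans M s s' * psi s'.
Proof. by move=> le; apply: ler_sum => s' _; rewrite ler_wpM2l// ltW. Qed.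

Lemma cexp_bound n h phi b : (forall h, `|phi h| <= b) -> `|cexp n h phi| <= b.
Proof.
move=> phib; elim: n h => //= n IH [|s h].
  (* On the empty history [cexp] defaults to 0, and [b] is nonnegative because it bounds a norm. *)
  by rewrite normr0 (le_trans _ (phib [::])).
apply: le_trans (ler_norm_sum _ _ _) _.
under eq_bigr do rewrite normrM (ger0_norm (ltW (trans_pos _ _))).
exact: trans_average_le.
Qed.

(** Histories are reversed, so [rcons] inserts an earlier initial shock, while transition
    probabilities depend only on the head. *)
Lemma cexp_rcons n s h s0 phi :
  cexp n (rcons (s :: h) s0) phi = cexp n (s :: h) (fun h' => phi (rcons h' s0)).
Proof. by elim: n s h => //= n IH s h; apply: eq_bigr => s' _; rewrite -IH. Qed.

Lemma eq_cexp n s h phi psi : (forall s' h', phi (s' :: h') = psi (s' :: h')) ->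
  cexp n (s :: h) phi = cexp n (s :: h) psi.
Proof. by move=> eq; elim: n s h => //= n IH s h; apply: eq_bigr => s' _; rewrite IH. Qed.

Definition stage a x f h : R :=
  match h with [::] => 0 | s :: _ => f (xstate a x h) (a h) s end.

Definition discounted a x f h : R^nat := fun n => beta M ^+ n * cexp n h (stage a x f).

Lemma valueE a x f h : value a x f h = limn (series (discounted a x f h)).
Proof. by []. Qed.

Definition bounded_by f b := forall y act s, `|f y act s| <= b.

Lemma discounted_bound a x f h b : 0 <= b -> bounded_by f b ->
  forall n, `|discounted a x f h n| <= geometric b (beta M) n.
Proof.
move=> b0 fb n; have betan0 : 0 <= beta M ^+ n by rewrite exprn_ge0// ltW.
rewrite /discounted /geometric /= normrM (ger0_norm betan0) mulrC ler_wpM2r//.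
by apply: cexp_bound => -[|s t] /=; rewrite ?normr0.
Qed.

Lemma beta_norm : `|beta M| < 1.
Proof. by rewrite gtr0_norm. Qed.

(** Comparison with a geometric series ensures that the [limn] defining [value] is a genuine
    limit. *)
Lemma value_cvg a x f h b : 0 <= b -> bounded_by f b ->
  series (discounted a x f h) @ \oo --> value a x f h.
Proof.
move=> b0 fb; rewrite valueE; apply: (@normed_cvg R R^o).
apply: series_le_cvg (is_cvg_geometric_series (a := b) beta_norm) => [n|n|n] //=.
  by rewrite mulr_ge0// exprn_ge0// ltW.
exact: discounted_bound.
Qed.

Lemma value_bound a x f h b : 0 <= b -> bounded_by f b ->
  `|value a x f h| <= b / (1 - beta M).
Proof.
move=> b0 fb; have val_cvg := value_cvg (a := a) (x := x) (h := h) b0 fb.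
apply: (@ler_cvg_to _ _ _ R _ _ _ _ (cvg_norm val_cvg)
  (cvg_geometric_series (a := b) beta_norm)).
apply: nearW => n; apply: le_trans (ler_norm_sum _ _ _) _.
by apply: ler_sum => k _; exact: discounted_bound.
Qed.

(** The plan from the next date on, once the initial shock [s] is known: [s] goes to the oldest end
    of the reversed history. *)
Definition continuation a s : plan M := fun h => a (rcons h s).

Lemma xstate_rcons a x s s' h : xstate a x (rcons (s' :: h) s) =
  xstate (continuation a s) (zeta M x (a [:: s]) s) (s' :: h).
Proof. by elim: h s' => // s2 h IH s1; rewrite /= in IH *; rewrite IH. Qed.

Lemma stage_rcons a x f s s' h : stage a x f (rcons (s' :: h) s) =
  stage (continuation a s) (zeta M x (a [:: s]) s) f (s' :: h).
Proof. by rewrite /stage -xstate_rcons. Qed.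

Lemma value_rcons a x f s s' h : value a x f (rcons (s' :: h) s) =
  value (continuation a s) (zeta M x (a [:: s]) s) f (s' :: h).
Proof.
rewrite !valueE; congr (limn (series _)); apply/funext => n.
rewrite /discounted cexp_rcons; congr (_ * _); apply: eq_cexp => s1 h1.
exact: stage_rcons.
Qed.

(** The partial sum of length [n+1] is the current payoff plus [beta] times the average of the
    continuation's partial sums of length [n]; both sides pass to the limit. *)
Lemma value_rec a x f s b : 0 <= b -> bounded_by f b ->
  value a x f [:: s] = f x (a [:: s]) s + beta M * \sum_(s' : St M) trans M s s' *
    value (continuation a s) (zeta M x (a [:: s]) s) f [:: s'].
Proof.
move=> b0 fb; pose x' := zeta M x (a [:: s]) s; pose a' := continuation a s.
pose partial n := f x (a [:: s]) s + beta M * \sum_(s' : St M) trans M s s' *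
  series (discounted a' x' f [:: s']) n.
have partialE n : series (discounted a x f [:: s]) n.+1 = partial n.
  rewrite /series /= big_nat_recl// {1}/discounted expr0 mul1r; congr (_ + _).
  transitivity (\sum_(0 <= k < n) beta M * \sum_(s' : St M) trans M s s' *
      discounted a' x' f [:: s'] k).
    apply: eq_bigr => k _; rewrite /discounted exprS -mulrA; congr (_ * _).
    rewrite /= mulr_sumr; apply: eq_bigr => s' _; rewrite mulrCA; congr (_ * (_ * _)).
    rewrite -[[:: s'; s]]/(rcons [:: s'] s) cexp_rcons; apply: eq_cexp => s1 h1.
    exact: stage_rcons.
  by rewrite -mulr_sumr exchange_big /=; under eq_bigr do rewrite -mulr_sumr.
have partial_cvg : partial @ \oo --> f x (a [:: s]) s +
    beta M * \sum_(s' : St M) trans M s s' * value a' x' f [:: s'].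
  apply: cvgD; first exact: cvg_cst.
  apply: cvgM; first exact: cvg_cst.
  by apply: cvgn_sum => s'; apply: cvgM; [exact: cvg_cst|exact: value_cvg fb].
apply: (cvg_unique _ _ partial_cvg) => //.
have := value_cvg (a := a) (x := x) (h := [:: s]) b0 fb.
rewrite -cvg_shiftS; apply: cvg_trans; apply: near_eq_cvg.
by apply: nearW => n; rewrite /= partialE.
Qed.

(** Feasibility is imposed at every history, and each history of the continuation becomes one of the
    original plan once [s] is appended. *)
Lemma feasible_continuation a x s s' : feasible a x s ->
  feasible (continuation a s) (zeta M x (a [:: s]) s) s'.
Proof.
move=> [a_adm a_val]; split=> [[|s1 h]|[|s1 h] i] // s1h.
  by rewrite -xstate_rcons; apply: (a_adm (rcons (s1 :: h) s)); rewrite /= last_rcons.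
by rewrite -value_rcons; apply: a_val; rewrite /= last_rcons.
Qed.

Lemma feasible_action a x s : feasible a x s -> Atil x s (a [:: s]).
Proof. by case=> /(_ [:: s] erefl) + _; rewrite inE. Qed.

Lemma feasible_value a x s i : feasible a x s ->
  gbar M i <= value a x (gfun M i) [:: s].
Proof. by case=> _; apply. Qed.

(** * Sup norms and the constant L *)

Lemma supnorm_ge f b : bounded_by f b -> bounded_by f (supnorm f).
Proof.
move=> fb y act s; apply: ub_le_sup; last by exists (y, act, s).
by exists b => _ [[[y' act'] s'] _ <-]; exact: fb.
Qed.

Lemma supnorm_ge0 f b : bounded_by f b -> 0 <= supnorm f.
Proof.
move=> fb; have [[[[y act] s] _]|noarg] := pselect (exists t : Xs M * Act M * St M, True).
  exact: le_trans (supnorm_ge fb y act s).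
(* With an empty domain the range is empty and [sup] takes its default value 0. *)
rewrite /supnorm [X in sup X](_ : _ = set0) ?sup0//.
by apply/seteqP; split=> // y [t _ _]; apply: noarg; exists t.
Qed.

Implicit Types (F G : mult M -> Xs M -> St M -> R) (gam lam : mult M) (act : Act M).

Local Notation L := (Lconst M).

Let beta_ge0 : 0 <= beta M := ltW beta_pos.

Lemma one_minus_beta_gt0 : 0 < 1 - beta M.
Proof. by rewrite subr_gt0. Qed.

(** In this form, [(1 - beta) L] bounds every one-period payoff, so that discounted values are
    bounded by [L]. *)
Lemma LconstE : (1 - beta M) * L =
  supnorm (rfun M) + \sum_(i < nI M) supnorm (gfun M i).
Proof. by rewrite /Lconst mulrC divfK// gt_eqF// one_minus_beta_gt0. Qed.

Lemma supnorm_g_ge0 i : 0 <= supnorm (gfun M i).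
Proof. by have [b gb] := g_bdd i; exact: supnorm_ge0 gb. Qed.

Lemma supnorm_r_ge0 : 0 <= supnorm (rfun M).
Proof. by have [b rb] := r_bdd; exact: supnorm_ge0 rb. Qed.

Lemma r_bound : bounded_by (rfun M) ((1 - beta M) * L).
Proof.
have [b rb] := r_bdd; move=> y act s; apply: le_trans (supnorm_ge rb y act s) _.
by rewrite LconstE lerDl sumr_ge0// => i _; exact: supnorm_g_ge0.
Qed.

Lemma g_bound i : bounded_by (gfun M i) ((1 - beta M) * L).
Proof.
have [b gb] := g_bdd i; move=> y act s; apply: le_trans (supnorm_ge gb y act s) _.
rewrite LconstE (bigD1 i)//= addrCA lerDl addr_ge0 ?supnorm_r_ge0//.
by rewrite sumr_ge0// => j _; exact: supnorm_g_ge0.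
Qed.

Lemma L_ge0 : 0 <= L.
Proof.
rewrite -(pmulr_rge0 _ one_minus_beta_gt0) LconstE addr_ge0 ?supnorm_r_ge0//.
by rewrite sumr_ge0// => i _; exact: supnorm_g_ge0.
Qed.

Let stage_bound_ge0 : 0 <= (1 - beta M) * L.
Proof. by rewrite mulr_ge0 ?L_ge0// ltW// one_minus_beta_gt0. Qed.

Let value_le_L a x f h : bounded_by f ((1 - beta M) * L) -> `|value a x f h| <= L.
Proof.
move=> fL; have := value_bound a x h stage_bound_ge0 fL.
by rewrite mulrAC divff ?mul1r// gt_eqF// one_minus_beta_gt0.
Qed.

Lemma plan_value_bound a x h gam : nonneg M gam ->
  `|value a x (rfun M) h + \sum_(i < nI M) gam i * value a x (gfun M i) h|
    <= (1 + \sum_(i < nI M) gam i) * L.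
Proof.
move=> gam0; apply: le_trans (ler_normD _ _) _; rewrite mulrDl mul1r lerD//.
  exact/value_le_L/r_bound.
apply: le_trans (ler_norm_sum _ _ _) _; rewrite mulr_suml; apply: ler_sum => i _.
by rewrite normrM ger0_norm// ler_wpM2l//; exact/value_le_L/g_bound.
Qed.

(** * The Bellman operator on functions satisfying (i)-(iv) *)

Definition rhs F gam lam x s act : R :=
  rfun M x act s
  + \sum_(i < nI M) (gam i * gfun M i x act s + lam i * (gfun M i x act s - gbar M i))
  + beta M * \sum_(s' : St M) trans M s s' *
               F (fun i => gam i + lam i) (zeta M x act s) s'.

Definition sup_rhs F gam lam x s : R := sup [set rhs F gam lam x s act | act in Atil x s].

Lemma BopE F gam x s : Bop F gam x s = inf [set sup_rhs F gam lam x s | lam in nonneg M].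
Proof. by []. Qed.

Lemma sup_rhs_le F gam lam x s c :
  (forall act, Atil x s act -> rhs F gam lam x s act <= c) -> sup_rhs F gam lam x s <= c.
Proof.
move=> rhs_le; apply: ge_sup; last by move=> _ [act /rhs_le act_le <-].
(* The first action of a feasible plan shows that the supremum is over a nonempty set. *)
have [a /feasible_action adm] := feasible_ex x s.
by exists (rhs F gam lam x s (a [:: s])); exists (a [:: s]).
Qed.

Lemma rhs_le_sup F gam lam x s act : Atil x s act ->
  rhs F gam lam x s act <= sup_rhs F gam lam x s.
Proof.
move=> adm; apply: ub_le_sup; last by exists act.
exists (\sum_(act' : Act M) `|rhs F gam lam x s act'|) => _ [act' _ <-].
by rewrite (bigD1 act')//= ler_wpDr ?ler_norm// sumr_ge0.
Qed.

(* Conditions (i)-(iv) in the definition of the space N. *)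
Definition N_conditions F : Prop :=
  (forall x s (g1 g2 : mult M) (t : R), nonneg M g1 -> nonneg M g2 -> 0 <= t <= 1 ->
     F (fun i => t * g1 i + (1 - t) * g2 i) x s <= t * F g1 x s + (1 - t) * F g2 x s) /\
  (forall x s (g1 g2 : mult M), nonneg M g1 -> nonneg M g2 ->
     `|F g1 x s - F g2 x s| <= L * \sum_(i < nI M) `|g1 i - g2 i|) /\
  (forall x s a gam, nonneg M gam -> feasible a x s ->
     value a x (rfun M) [:: s] + \sum_(i < nI M) gam i * value a x (gfun M i) [:: s]
       <= F gam x s) /\
  (forall x s gam, nonneg M gam -> F gam x s <= (1 + \sum_(i < nI M) gam i) * L).

Lemma nonnegD gam lam : nonneg M gam -> nonneg M lam -> nonneg M (fun i => gam i + lam i).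
Proof. by move=> gam0 lam0 i; rewrite addr_ge0. Qed.

Lemma nonneg0 : nonneg M (fun=> 0).
Proof. by move=> i. Qed.

(** The lower half comes from (iii) applied to some feasible plan, whose weighted value is itself
    bounded by the same expression. *)
Lemma N_bound F gam x s : N_conditions F -> nonneg M gam ->
  `|F gam x s| <= (1 + \sum_(i < nI M) gam i) * L.
Proof.
move=> [_ [_ [F_lb F_ub]]] gam0; rewrite ler_norml F_ub// andbT.
have [a a_feas] := feasible_ex x s; apply: le_trans (F_lb x s a gam gam0 a_feas).
by have := plan_value_bound a x [:: s] gam0; rewrite ler_norml => /andP[].
Qed.

(** By (iii) at the successors and the value recursion, the bracket exceeds the plan's weighted
    value by at least the sum of [lam i * (v^i - gbar i)], which is nonnegative by feasibility. *)
Lemma rhs_lower F gam lam x s a : N_conditions F -> nonneg M gam -> nonneg M lam ->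
  feasible a x s ->
  value a x (rfun M) [:: s] + \sum_(i < nI M) gam i * value a x (gfun M i) [:: s]
    <= rhs F gam lam x s (a [:: s]).
Proof.
move=> [_ [_ [F_lb _]]] gam0 lam0 a_feas.
pose x' := zeta M x (a [:: s]) s; pose a' := continuation a s.
pose W f := \sum_(s' : St M) trans M s s' * value a' x' f [:: s'].
have rec f : bounded_by f ((1 - beta M) * L) ->
    value a x f [:: s] = f x (a [:: s]) s + beta M * W f.
  by move=> fb; exact: (value_rec _ _ _ stage_bound_ge0 fb).
(* Condition (iii) applied to the continuation plan at each successor state. *)
have F_ge : W (rfun M) + \sum_(i < nI M) (gam i + lam i) * W (gfun M i) <=
    \sum_(s' : St M) trans M s s' * F (fun i => gam i + lam i) x' s'.
  apply: le_trans (trans_average_mono s (fun s' => F_lb x' s' a' _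
    (nonnegD gam0 lam0) (feasible_continuation s' a_feas))).
  rewrite le_eqVlt; apply/orP; left; apply/eqP.
  under [RHS]eq_bigr do rewrite mulrDr mulr_sumr.
  rewrite big_split /=; congr (_ + _); rewrite exchange_big /=.
  by apply: eq_bigr => i _; rewrite mulr_sumr; apply: eq_bigr => s' _; rewrite mulrCA.
apply: (@le_trans _ _ (rfun M x (a [:: s]) s + \sum_(i < nI M)
    (gam i * gfun M i x (a [:: s]) s + lam i * (gfun M i x (a [:: s]) s - gbar M i))
    + beta M * (W (rfun M) + \sum_(i < nI M) (gam i + lam i) * W (gfun M i)))); last first.
  by rewrite lerD2l ler_wpM2l.
rewrite (rec _ r_bound) mulrDr addrACA lerD2l mulr_sumr -big_split /=.
apply: ler_sum => i _.
have := feasible_value i a_feas; rewrite (rec _ (g_bound i)) => g_ge.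
have : 0 <= lam i * (gfun M i x (a [:: s]) s + beta M * W (gfun M i) - gbar M i).
  by rewrite mulr_ge0// subr_ge0.
move: (gam i) (lam i) (gfun M i _ _ _) (gbar M i) (beta M) (W _) => c l g gb b w.
by rewrite -subr_ge0 => lg; rewrite -subr_ge0; move: lg; rewrite subr0; congr (_ <= _); ring.
Qed.

Lemma sup_rhs_lower F gam lam x s a : N_conditions F -> nonneg M gam -> nonneg M lam ->
  feasible a x s ->
  value a x (rfun M) [:: s] + \sum_(i < nI M) gam i * value a x (gfun M i) [:: s]
    <= sup_rhs F gam lam x s.
Proof.
move=> NF gam0 lam0 a_feas; apply: le_trans (rhs_lower NF gam0 lam0 a_feas) _.
exact/rhs_le_sup/feasible_action.
Qed.

Lemma le_Bop F gam x s c :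
  (forall lam, nonneg M lam -> c <= sup_rhs F gam lam x s) -> c <= Bop F gam x s.
Proof.
move=> le; rewrite BopE; apply: lb_le_inf; last by move=> _ [lam /le ? <-].
by exists (sup_rhs F gam (fun=> 0) x s); exists (fun=> 0) => //; exact: nonneg0.
Qed.

(** The lower bound given by a feasible plan does not involve [lam], so [inf] is a genuine
    infimum. *)
Lemma sup_rhs_has_inf F gam x s : N_conditions F -> nonneg M gam ->
  has_inf [set sup_rhs F gam lam x s | lam in nonneg M].
Proof.
move=> NF gam0; split.
  by exists (sup_rhs F gam (fun=> 0) x s); exists (fun=> 0) => //; exact: nonneg0.
have [a a_feas] := feasible_ex x s.
by eexists => _ [lam lam0 <-]; exact: sup_rhs_lower NF gam0 lam0 a_feas.
Qed.

Lemma Bop_le F gam lam x s : N_conditions F -> nonneg M gam -> nonneg M lam ->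
  Bop F gam x s <= sup_rhs F gam lam x s.
Proof.
move=> NF gam0 lam0; rewrite BopE; apply: ge_inf; last by exists lam.
by have [] := sup_rhs_has_inf x s NF gam0.
Qed.

Lemma Bop_approx F gam x s e : N_conditions F -> nonneg M gam -> 0 < e ->
  exists2 lam, nonneg M lam & sup_rhs F gam lam x s <= Bop F gam x s + e.
Proof.
move=> NF gam0 e0.
have [_ [lam lam0 <-] /ltW le] := inf_adherent e0 (sup_rhs_has_inf x s NF gam0).
by exists lam.
Qed.

Lemma rhs_mono F G gam lam x s act : nonneg M gam -> nonneg M lam ->
  (forall g y s', nonneg M g -> F g y s' <= G g y s') ->
  rhs F gam lam x s act <= rhs G gam lam x s act.
Proof.
move=> gam0 lam0 FG; rewrite lerD2l ler_wpM2l//.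
by apply: trans_average_mono => s'; exact/FG/nonnegD.
Qed.

(** Comparison on the nonnegative orthant is enough, because [gam + lam] stays in it. *)
Lemma Bop_mono F G gam x s : N_conditions F ->
  (forall g y s', nonneg M g -> F g y s' <= G g y s') -> nonneg M gam ->
  Bop F gam x s <= Bop G gam x s.
Proof.
move=> NF FG gam0; apply: le_Bop => lam lam0.
apply: le_trans (Bop_le x s NF gam0 lam0) _; apply: sup_rhs_le => act adm.
exact: le_trans (rhs_mono _ _ _ gam0 lam0 FG) (rhs_le_sup _ _ _ adm).
Qed.

(** Convexity is joint in [(gam, lam)], which is what lets it survive the infimum over [lam]. *)
Lemma rhs_convex F (g1 g2 l1 l2 : mult M) t x s act : N_conditions F ->
  nonneg M g1 -> nonneg M g2 -> nonneg M l1 -> nonneg M l2 -> 0 <= t <= 1 ->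
  rhs F (fun i => t * g1 i + (1 - t) * g2 i) (fun i => t * l1 i + (1 - t) * l2 i) x s act
    <= t * rhs F g1 l1 x s act + (1 - t) * rhs F g2 l2 x s act.
Proof.
move=> [F_cvx _] g10 g20 l10 l20 t01; rewrite /rhs.
rewrite (_ : (fun i => _ + _) = fun i => t * (g1 i + l1 i) + (1 - t) * (g2 i + l2 i)); last first.
  by apply/funext => i; ring.
have := trans_average_mono s (fun s' => F_cvx (zeta M x act s) s' _ _ _
  (nonnegD g10 l10) (nonnegD g20 l20) t01).
move=> /(ler_wpM2l beta_ge0) /le_trans EF.
rewrite -lerBrDl; apply: EF.
under eq_bigr do rewrite mulrDr ![trans M s _ * (_ * F _ _ _)]mulrCA.
rewrite big_split /= -!mulr_sumr.
rewrite (_ : \sum_(i < nI M) ((t * g1 i + (1 - t) * g2 i) * gfun M i x act s +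
    (t * l1 i + (1 - t) * l2 i) * (gfun M i x act s - gbar M i)) =
  t * (\sum_(i < nI M) (g1 i * gfun M i x act s + l1 i * (gfun M i x act s - gbar M i))) +
  (1 - t) * (\sum_(i < nI M) (g2 i * gfun M i x act s + l2 i * (gfun M i x act s - gbar M i)))).
  by rewrite le_eqVlt; apply/orP; left; apply/eqP; ring.
by rewrite !mulr_sumr -big_split /=; apply: eq_bigr => i _; ring.
Qed.

(** The terms in [lam] cancel; payoffs contribute [(1 - beta) L] and the continuation [beta L], so
    the constant [L] is reproduced. *)
Lemma rhs_lipschitz F (g1 g2 lam : mult M) x s act : N_conditions F ->
  nonneg M g1 -> nonneg M g2 -> nonneg M lam ->
  rhs F g1 lam x s act <= rhs F g2 lam x s act + L * \sum_(i < nI M) `|g1 i - g2 i|.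
Proof.
move=> [_ [F_lip _]] g10 g20 lam0; set d := \sum_(i < nI M) _.
have EF : \sum_(s' : St M) trans M s s' * F (fun i => g1 i + lam i) (zeta M x act s) s' <=
    \sum_(s' : St M) trans M s s' * F (fun i => g2 i + lam i) (zeta M x act s) s' + L * d.
  rewrite -[L * d]mul1r -(trans_sum s) mulr_suml -big_split /=.
  apply: ler_sum => s' _; rewrite -mulrDr ler_wpM2l ?(ltW (trans_pos _ _))//.
  rewrite -lerBlDl; apply: le_trans (ler_norm _) _.
  apply: le_trans (F_lip _ _ _ _ (nonnegD g10 lam0) (nonnegD g20 lam0)) _.
  by under eq_bigr do rewrite /= opprD addrACA subrr addr0.
have EG : \sum_(i < nI M) (g1 i * gfun M i x act s + lam i * (gfun M i x act s - gbar M i)) <=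
    \sum_(i < nI M) (g2 i * gfun M i x act s + lam i * (gfun M i x act s - gbar M i))
    + (1 - beta M) * L * d.
  rewrite mulr_sumr -big_split /=; apply: ler_sum => i _.
  rewrite addrAC lerD2r -lerBlDl -mulrBl; apply: le_trans (ler_norm _) _.
  by rewrite normrM mulrC ler_wpM2r// g_bound.
have {}EF := ler_wpM2l beta_ge0 EF.
rewrite /rhs -addrA -[leRHS]addrA -addrA lerD2l.
apply: le_trans (lerD EG EF) _; rewrite le_eqVlt; apply/orP; left; apply/eqP; ring.
Qed.

Lemma F0_N : N_conditions (F0 M).
Proof.
have L0 := L_ge0; split; [|split; [|split]].
- move=> x s g1 g2 t _ _ _; rewrite /F0 big_split /= -!mulr_sumr.
  by rewrite le_eqVlt; apply/orP; left; apply/eqP; ring.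
- move=> x s g1 g2 _ _; rewrite /F0 -mulrBl opprD addrACA subrr add0r -sumrB.
  by rewrite normrM mulrC (ger0_norm L0) ler_wpM2l// ler_norm_sum.
- move=> x s a gam gam0 _; apply: le_trans (ler_norm _) _; exact: plan_value_bound.
- by [].
Qed.

(** At [lam = 0] the constraint terms vanish, and the bounds with factors [(1 - beta) L] and
    [beta L] add up to (iv). *)
Lemma rhs0_le F gam x s act : N_conditions F -> nonneg M gam ->
  rhs F gam (fun=> 0) x s act <= (1 + \sum_(i < nI M) gam i) * L.
Proof.
move=> [_ [_ [_ F_ub]]] gam0.
have EF := ler_wpM2l beta_ge0 (trans_average_le s
  (fun s' => F_ub (zeta M x act s) s' _ (nonnegD gam0 nonneg0))).
have sum0 : \sum_(i < nI M) (gam i + 0) = \sum_(i < nI M) gam i.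
  by apply: eq_bigr => i _; rewrite addr0.
rewrite /= sum0 in EF.
have EG : rfun M x act s + \sum_(i < nI M) (gam i * gfun M i x act s
    + 0 * (gfun M i x act s - gbar M i)) <=
    (1 + \sum_(i < nI M) gam i) * ((1 - beta M) * L).
  rewrite mulrDl mul1r lerD//; first exact: le_trans (ler_norm _) (r_bound _ _ _).
  rewrite mulr_suml; apply: ler_sum => i _; rewrite mul0r addr0 ler_wpM2l//.
  exact: le_trans (ler_norm _) (g_bound _ _ _ _).
apply: le_trans (lerD EG EF) _.
by rewrite le_eqVlt; apply/orP; left; apply/eqP; ring.
Qed.

Lemma Bop_N F : N_conditions F -> N_conditions (Bop F).
Proof.
move=> NF; split; [|split; [|split]].
- move=> x s g1 g2 t g10 g20 t01; apply/ler_addgt0Pr => e e0.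
  have /andP[t0 t1] := t01.
  (* The infima need not be attained, so [e]-optimal multipliers are used; their mixture is a
     competitor at the mixed point. *)
  have [l1 l10 sup1] := Bop_approx x s NF g10 e0.
  have [l2 l20 sup2] := Bop_approx x s NF g20 e0.
  have s0 : 0 <= 1 - t by rewrite subr_ge0.
  apply: (@le_trans _ _ (t * sup_rhs F g1 l1 x s + (1 - t) * sup_rhs F g2 l2 x s)).
    have gm0 : nonneg M (fun i => t * g1 i + (1 - t) * g2 i).
      by move=> i; rewrite addr_ge0// mulr_ge0.
    have lm0 : nonneg M (fun i => t * l1 i + (1 - t) * l2 i).
      by move=> i; rewrite addr_ge0// mulr_ge0.
    apply: le_trans (Bop_le x s NF gm0 lm0) _; apply: sup_rhs_le => act adm.
    apply: le_trans (rhs_convex _ _ _ NF g10 g20 l10 l20 t01) _.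
    by rewrite lerD// ler_wpM2l// rhs_le_sup.
  apply: le_trans (lerD (ler_wpM2l t0 sup1) (ler_wpM2l s0 sup2)) _.
  by rewrite le_eqVlt; apply/orP; left; apply/eqP; ring.
- have half x s (g1 g2 : mult M) : nonneg M g1 -> nonneg M g2 ->
      Bop F g1 x s <= Bop F g2 x s + L * \sum_(i < nI M) `|g1 i - g2 i|.
    move=> g10 g20; rewrite -lerBlDr; apply: le_Bop => lam lam0; rewrite lerBlDr.
    apply: le_trans (Bop_le x s NF g10 lam0) _; apply: sup_rhs_le => act adm.
    apply: le_trans (rhs_lipschitz _ _ _ NF g10 g20 lam0) _.
    by rewrite lerD2r rhs_le_sup.
  move=> x s g1 g2 g10 g20; rewrite ler_distl lerBlDr half// andbT.
  by under eq_bigr do rewrite distrC; exact: half.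
- by move=> x s a gam gam0 a_feas; apply: le_Bop => lam lam0; exact: sup_rhs_lower.
- move=> x s gam gam0; apply: le_trans (Bop_le x s NF gam0 nonneg0) _.
  by apply: sup_rhs_le => act _; exact: rhs0_le.
Qed.

(** * The iterates from F_0 and their limit *)

Definition iterB n := iter n (@Bop R M) (F0 M).

Lemma iterB_N n : N_conditions (iterB n).
Proof. by elim: n => [|n IH] /=; [exact: F0_N|exact: Bop_N]. Qed.

Lemma iterB_succ_le n gam x s : nonneg M gam -> iterB n.+1 gam x s <= iterB n gam x s.
Proof.
elim: n gam x s => [|n IH] gam x s gam0.
  (* Condition (iv) for the first iterate says precisely that it lies below [F0 M]. *)
  by have [_ [_ [_ ub]]] := iterB_N 1; exact: ub.
rewrite -[iterB n.+2]/(Bop (iterB n.+1)) -[X in _ <= X gam x s]/(Bop (iterB n)).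
by apply: Bop_mono => //; exact: iterB_N.
Qed.

Definition limB : mult M -> Xs M -> St M -> R :=
  fun gam x s => limn (fun n => iterB n gam x s).

Lemma iterB_nonincreasing gam x s : nonneg M gam ->
  nonincreasing_seq (fun n => iterB n gam x s).
Proof. by move=> gam0; apply/nonincreasing_seqP => n; exact: iterB_succ_le. Qed.

Lemma iterB_cvg gam x s : nonneg M gam -> iterB n gam x s @[n --> \oo] --> limB gam x s.
Proof.
move=> gam0; apply: nonincreasing_is_cvgn; first exact: iterB_nonincreasing.
exists (- ((1 + \sum_(i < nI M) gam i) * L)) => _ [n _ <-].
by have := N_bound x s (iterB_N n) gam0; rewrite ler_norml => /andP[].
Qed.

Arguments iterB_cvg {gam} x s gam0.

Lemma limB_le n gam x s : nonneg M gam -> limB gam x s <= iterB n gam x s.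
Proof.
move=> gam0; apply: (nonincreasing_cvgn_ge (u_ := fun n => iterB n gam x s)).
  exact: iterB_nonincreasing.
exact: iterB_cvg.
Qed.

Lemma limB_N : N_conditions limB.
Proof.
split; [|split; [|split]].
- move=> x s g1 g2 t g10 g20 t01; have /andP[t0 t1] := t01.
  have gm0 : nonneg M (fun i => t * g1 i + (1 - t) * g2 i).
    by move=> i; rewrite addr_ge0// mulr_ge0// subr_ge0.
  have mix_cvg : t * iterB n g1 x s + (1 - t) * iterB n g2 x s @[n --> \oo] -->
      t * limB g1 x s + (1 - t) * limB g2 x s.
    by apply: cvgD; apply: cvgM; [exact: cvg_cst|exact: iterB_cvg|
      exact: cvg_cst|exact: iterB_cvg].
  apply: (@ler_cvg_to _ _ _ R _ _ _ _ (iterB_cvg x s gm0) mix_cvg).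
  by apply: nearW => n; have [cvx _] := iterB_N n; exact: cvx.
- move=> x s g1 g2 g10 g20.
  apply: (cvgr_to_le (cvg_norm (cvgB (iterB_cvg x s g10) (iterB_cvg x s g20)))).
  by apply: nearW => n; have [_ [lip _]] := iterB_N n; exact: lip.
- move=> x s a gam gam0 a_feas; apply: (cvgr_to_ge (iterB_cvg x s gam0)).
  by apply: nearW => n; have [_ [_ [lb _]]] := iterB_N n; exact: lb.
- move=> x s gam gam0; apply: (cvgr_to_le (iterB_cvg x s gam0)).
  by apply: nearW => n; have [_ [_ [_ ub]]] := iterB_N n; exact: ub.
Qed.

Lemma rhs_iterB_cvg gam lam x s act : nonneg M gam -> nonneg M lam ->
  rhs (iterB n) gam lam x s act @[n --> \oo] --> rhs limB gam lam x s act.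
Proof.
move=> gam0 lam0; apply: cvgD; first exact: cvg_cst.
apply: cvgM; first exact: cvg_cst.
apply: cvgn_sum => s'; apply: cvgM; first exact: cvg_cst.
exact/iterB_cvg/nonnegD.
Qed.

Arguments rhs_iterB_cvg {gam lam} x s act gam0 lam0.

(* The actions are finitely many, so sup and limit commute for each fixed lambda; hence
   no uniformity in lambda is needed. *)
Lemma limB_fixed gam x s : nonneg M gam -> Bop limB gam x s = limB gam x s.
Proof.
move=> gam0; apply/eqP; rewrite eq_le; apply/andP; split.
  (* Monotonicity puts [Bop limB] below every [iterB n.+1], and the shifted sequence has the same
     limit. *)
  have succ_cvg : iterB n.+1 gam x s @[n --> \oo] --> limB gam x s.
    by rewrite (cvg_shiftS (fun n => iterB n gam x s)); exact: iterB_cvg.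
  apply: (cvgr_to_ge succ_cvg).
  by apply: nearW => n; apply: Bop_mono => // [|g y s' g0]; [exact: limB_N|exact: limB_le].
apply: le_Bop => // lam lam0; apply/ler_addgt0Pr => e e0.
have : \forall n \near \oo, forall act,
    rhs (iterB n) gam lam x s act <= rhs limB gam lam x s act + e.
  apply: filter_forall => act.
  have /cvgrPdist_le/(_ _ e0) := rhs_iterB_cvg x s act gam0 lam0.
  by apply: filterS => n; rewrite ler_distlC => /andP[_].
(* A single late [n] suffices: [limB] lies below [iterB n.+1], hence below the supremum for
   [iterB n] at this [lam]. *)
case=> n _ /(_ n (leqnn n)) rhs_n.
apply: le_trans (limB_le n.+1 x s gam0) _.
apply: le_trans (Bop_le x s (iterB_N n) gam0 lam0) _.
apply: sup_rhs_le => // act adm; apply: le_trans (rhs_n act) _.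
by rewrite lerD2r; exact: rhs_le_sup.
Qed.

Lemma limB_largest F : N_conditions F ->
  (forall gam x s, nonneg M gam -> Bop F gam x s = F gam x s) ->
  forall gam x s, nonneg M gam -> F gam x s <= limB gam x s.
Proof.
move=> NF F_fix gam x s gam0; apply: (cvgr_to_ge (iterB_cvg x s gam0)).
apply: nearW => n; elim: n gam x s gam0 => [|n IH] gam x s gam0.
  by have [_ [_ [_ ub]]] := NF; exact: ub.
by rewrite -F_fix//; apply: Bop_mono.
Qed.

(** Measurability follows from the Lipschitz condition, and both finiteness requirements from linear
    growth. *)
Lemma limB_inM : inM limB.
Proof.
have L0 := L_ge0.
have bound : growth_bound limB L by move=> x s g g0; exact: N_bound limB_N g0.
split=> [k x s k0|]; last exact: mnorm_lty bound.
split; last by apply: le_lt_trans (Linf_growth k L0 _) (ltry _) => g; exact: bound.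
by apply: (@lmeas_fun_lipschitz _ _ _ L) => g1 g2; have [_ [lip _]] := limB_N; exact: lip.
Qed.

Lemma iterB_mnorm_cvg :
  mnorm (fun gam x s => iterB n gam x s - limB gam x s) @[n --> \oo] --> 0%E.
Proof.
have L0 := L_ge0.
apply: (@mnorm_cvg0 _ _ _ (2 * L)) => [|n x s g g0|x s k e e0]; first by rewrite mulr_ge0.
  apply: le_trans (ler_normB _ _) _.
  apply: le_trans (lerD (N_bound _ _ (iterB_N n) g0) (N_bound _ _ limB_N g0)) _ => //.
  by rewrite le_eqVlt; apply/orP; left; apply/eqP; ring.
apply: (equilipschitz_uniform_cvg (K := L)) => // [n g1 g2|g1 g2|g g0].
- by have [_ [lip _]] := iterB_N n; exact: lip.
- by have [_ [lip _]] := limB_N; exact: lip.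
- exact: iterB_cvg.
Qed.

End DynamicProgram.

Theorem theorem3p6 (R : realType) (M : model R)
  (trans_pos : forall s s' : St M, 0 < trans M s s')
  (trans_sum : forall s : St M, \sum_(s' : St M) trans M s s' = 1)
  (xenum_surj : forall x : Xs M, exists j, xenum M j = Some x)
  (xenum_inj : forall j j' x, xenum M j = Some x -> xenum M j' = Some x -> j = j')
  (r_bdd : exists b : R, forall x a s, `|rfun M x a s| <= b)
  (g_bdd : forall i, exists b : R, forall x a s, `|gfun M i x a s| <= b)
  (beta_pos : 0 < beta M) (beta_lt1 : beta M < 1)
  (feasible_ex : forall x s, exists a : plan M, feasible a x s) :
  exists Fstar : mult M -> Xs M -> St M -> R,
    inN Fstar /\
    ((fun n => mnorm (fun gam x s => iter n (@Bop R M) (F0 M) gam x s - Fstar gam x s))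
       @ \oo --> 0%E) /\
    (forall gam x s, nonneg M gam -> Bop Fstar gam x s = Fstar gam x s) /\
    (forall F : mult M -> Xs M -> St M -> R, inN F ->
       (forall gam x s, nonneg M gam -> Bop F gam x s = F gam x s) ->
       forall gam x s, nonneg M gam -> F gam x s <= Fstar gam x s).
Proof.
exists limB; split; [|split; [|split]].
- by split; [exact: limB_inM|exact: limB_N].
- exact: iterB_mnorm_cvg.
- by move=> gam x s; exact: limB_fixed.
- by move=> F [_ NF]; exact: limB_largest.
Qed.
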